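(* Let $n\ge2$ and let $E_1,\dots,E_n$ be Banach spaces over $\mathbb{K}$ such that $E_3',\dots,E_n'$ have the Littlewood-Orlicz property and every continuous bilinear form on $E_1\times E_2$ is $2$-dominated. If $A\colon E_1\times\cdots\times E_n\to\mathbb{K}$ is multilinear and bounded, then $\hat A\colon\ell_2^w(E_1)\times\cdots\times\ell_2^w(E_n)\to\ell_1$ is also bounded. In other words, $\mathcal{L}(E_1,\dots,E_n;\mathbb{K})=\Pi_{(1;2,\dots,2)}(E_1,\dots,E_n;\mathbb{K})$.
   Context: $\mathbb{K}=\mathbb{R}$ or $\mathbb{C}$. $E'$ is the topological dual of $E$ and $B_E$ its closed unit ball. $\mathcal{L}(E_1,\dots,E_n;F)$ is the Banach space of continuous $n$-linear maps $E_1\times\cdots\times E_n\to F$. For $0<p\le\infty$, $\ell_p^w(E)$ is the space of sequences $(x_j)_j$ in $E$ with $(\varphi(x_j))_j\in\ell_p$ for all $\varphi\in E'$, with $\|(x_j)_j\|_{\ell_p^w(E)}=\sup_{\varphi\in B_{E'}}(\sum_j|\varphi(x_j)|^p)^{1/p}$. ''$\hat A\colon X_1\times\cdots\times X_n\to Y$ is bounded'' (for spaces of sequences $X_i$ in $E_i$, $Y$ in $F$) means that $((x_j^1)_j,\dots,(x_j^n)_j)\mapsto(A(x_j^1,\dots,x_j^n))_j$ is well defined with values in $Y$ and continuous. $A$ is absolutely $(p;p_1,\dots,p_n)$-summing if there is $C>0$ with $\|(A(x_j^1,\dots,x_j^n))_j\|_{p}\le C\prod_{i=1}^n\|(x_j^i)_j\|_{\ell_{p_i}^w(E_i)}$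 for all finite families (equivalently $\hat A\colon\ell_{p_1}^w(E_1)\times\cdots\times\ell_{p_n}^w(E_n)\to\ell_p(F)$ is bounded); $\Pi_{(p;p_1,\dots,p_n)}(E_1,\dots,E_n;F)$ is the space of such maps. A bilinear form on $E_1\times E_2$ is $2$-dominated if it is absolutely $(1;2,2)$-summing. A Banach space $E$ has the Littlewood-Orlicz property if $\ell_1^w(E)$ is continuously contained in the (completed) projective tensor product $\ell_2\otimes_\pi E$, viewed as a space of $E$-valued sequences via $(x_j)_j\leftrightarrow\sum_j e_j\otimes x_j$. *)

(* Defs.v *)
From HB Require Import structures.
From mathcomp Require Import all_boot all_order all_algebra.
From mathcomp Require Import all_classical all_reals all_analysis.
From mathcomp Require Import complex.

Set Implicit Arguments.
Unset Strict Implicit.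
Unset Printing Implicit Defensive.

Import Order.TTheory GRing.Theory Num.Theory.
Import numFieldNormedType.Exports.

Local Open Scope classical_set_scope.
Local Open Scope ring_scope.

Variant scalar_kind := RealScalars | ComplexScalars.

Definition scalars (R : realType) (k : scalar_kind) : numFieldType :=
  match k with
  | RealScalars => R
  | ComplexScalars => R[i]
  end.

Definition to_real (R : realType) (k : scalar_kind) : scalars R k -> R :=
  match k with
  | RealScalars => id
  | ComplexScalars => @complex.Re R
  end.

Definition of_real (R : realType) (k : scalar_kind) : R -> scalars R k :=
  match k with
  | RealScalars => id
  | ComplexScalars => real_complex R
  end.
Arguments of_real {R} k.

Section scalars_theory.
Context {R : realType} {k : scalar_kind}.
Local Notation K := (scalars R k).

Lemma of_realK : cancel (of_real k) (@to_real R k).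
Proof. by rewrite /of_real /to_real; case: k. Qed.

Lemma to_realK (x : K) : 0 <= x -> of_real k (to_real x) = x.
Proof.
rewrite /of_real /to_real; case: k x => //= x x0.
by rewrite RRe_real// ger0_real.
Qed.

Lemma ler_of_real (x y : R) : (of_real k x <= of_real k y) = (x <= y).
Proof. by rewrite /of_real; case: k => //=; rewrite lecR. Qed.

Lemma of_realD (x y : R) : of_real k (x + y) = of_real k x + of_real k y.
Proof. by rewrite /of_real; case: k => //=; rewrite rmorphD. Qed.

Lemma of_realM (x y : R) : of_real k (x * y) = of_real k x * of_real k y.
Proof. by rewrite /of_real; case: k => //=; rewrite rmorphM. Qed.

Lemma of_real0 : of_real k 0 = 0 :> K.
Proof. by rewrite /of_real; case: k. Qed.

Lemma of_real1 : of_real k 1 = 1 :> K.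
Proof. by rewrite /of_real; case: k. Qed.

(* The library's norm takes its values in the scalars; this is the same norm
   with values in the reals. *)
Definition rnorm (V : normedZmodType K) (x : V) : R := to_real `|x|.

Lemma of_real_rnorm (V : normedZmodType K) (x : V) :
  of_real k (rnorm x) = `|x|.
Proof. by rewrite /rnorm to_realK. Qed.

Lemma rnorm_leE (V : normedZmodType K) (x : V) (r : R) :
  (rnorm x <= r) = (`|x| <= of_real k r).
Proof. by rewrite -ler_of_real of_real_rnorm. Qed.

End scalars_theory.

Section dual.
Context {R : realType} {k : scalar_kind}.
Local Notation K := (scalars R k).
Variable E : normedModType K.

Definition continuous_linear_form : {pred E -> K^o} :=
  mem [set f : E -> K^o | linear f /\ continuous f].

Record dual := Dual {
  dual_fun :> E -> K^o ;
  dualP : dual_fun \in continuous_linear_form }.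

HB.instance Definition _ := [isSub for dual_fun].
HB.instance Definition _ := [Choice of dual by <:].

Lemma continuous_linear_form_submod : submod_closed continuous_linear_form.
Proof.
split=> [|a f g]; rewrite !inE /=.
  by split=> [b x y|x]; [rewrite scaler0 addr0|exact: cvg_cst].
move=> [lf cf] [lg cg]; split=> [b x y|x].
  have fgE z : (a *: f + g) z = a *: f z + g z by [].
  by rewrite !fgE lf lg !scalerDr !scalerA (mulrC b a) addrACA.
by apply: cvgD; [apply: cvgZr; exact: cf|exact: cg].
Qed.

HB.instance Definition _ := GRing.isSubmodClosed.Build K (E -> K^o)
  continuous_linear_form continuous_linear_form_submod.
HB.instance Definition _ := [SubChoice_isSubLmodule of dual by <:].


Lemma dual_linear (f : dual) : linear f.
Proof. by have := dualP f; rewrite inE => -[]. Qed.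

Lemma dual_continuous (f : dual) : continuous f.
Proof. by have := dualP f; rewrite inE => -[]. Qed.

Lemma dualD (f g : dual) x : (f + g) x = f x + g x.
Proof. by []. Qed.

Lemma dualZ (a : K) (f : dual) x : (a *: f) x = a *: f x.
Proof. by []. Qed.

Definition opnorm (f : dual) : R :=
  sup [set rnorm (f x) | x in [set x : E | rnorm x <= 1]].

Let dual0 (f : dual) : f 0 = 0.
Proof.
have := dual_linear f 1 0 0; rewrite !scale1r addr0 => /eqP.
by rewrite -subr_eq subrr => /eqP.
Qed.

Let dualZx (f : dual) a x : f (a *: x) = a *: f x.
Proof. by have := dual_linear f a x 0; rewrite dual0 !addr0. Qed.

Lemma opnorm_has_sup (f : dual) :
  has_sup [set rnorm (f x) | x in [set x : E | rnorm x <= 1]].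
Proof.
split.
  by exists (rnorm (f 0)), 0; rewrite //= rnorm_leE normr0 of_real1.
pose L : {linear E -> K^o} :=
  HB.pack (f : E -> K^o) (GRing.isLinear.Build _ _ _ _ _ (dual_linear f)).
have /linear_boundedP/pinfty_ex_gt0[M M0 fM] : bounded_near L (nbhs 0).
  by apply/linear_bounded_continuous; exact: dual_continuous.
exists (to_real M) => _ [x x1 <-]; move: x1.
rewrite /= !rnorm_leE of_real1 (to_realK (ltW M0)) => x1.
by apply: (le_trans (fM x)); rewrite ler_piMr// ltW.
Qed.

Lemma opnorm_ge0 (f : dual) : 0 <= opnorm f.
Proof.
have [[r [x x1 _]] fub] := opnorm_has_sup f.
have : rnorm (f x) <= opnorm f by apply: ub_le_sup => //; exists x.
by rewrite rnorm_leE -(@ler_of_real R k) of_real0; exact: le_trans.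
Qed.

Lemma opnormP (f : dual) (x : E) : `|f x| <= of_real k (opnorm f) * `|x|.
Proof.
have [->|x0] := eqVneq x 0; first by rewrite dual0 !normr0 mulr0.
have nx0 : 0 < `|x| by rewrite normr_gt0.
rewrite -ler_pdivrMr//.
have -> : `|f x| / `|x| = `|f (`|x|^-1 *: x)|.
  by rewrite dualZx normrZ normfV normr_id mulrC.
rewrite -rnorm_leE; apply: ub_le_sup; first exact: (opnorm_has_sup f).2.
exists (`|x|^-1 *: x) => //=.
by rewrite rnorm_leE of_real1 normrZ normfV normr_id mulVf ?gt_eqF.
Qed.

Lemma opnorm_le (f : dual) (M : R) :
  (forall x : E, rnorm x <= 1 -> rnorm (f x) <= M) -> opnorm f <= M.
Proof.
move=> fM; apply: ge_sup; first exact: (opnorm_has_sup f).1.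
by move=> _ [x x1 <-]; exact: fM.
Qed.

Let dual_norm (f : dual) : K := of_real k (opnorm f).

Let dual_norm_ge0 f : 0 <= dual_norm f.
Proof. by rewrite -(@of_real0 R k) ler_of_real opnorm_ge0. Qed.

Let dual_normD (f g : dual) : dual_norm (f + g) <= dual_norm f + dual_norm g.
Proof.
rewrite /dual_norm -of_realD ler_of_real; apply: opnorm_le => x.
rewrite !rnorm_leE of_real1 dualD of_realD => x1.
apply: (le_trans (ler_normD _ _)); apply: lerD.
- by apply: (le_trans (opnormP f x)); rewrite ler_piMr// dual_norm_ge0.
- by apply: (le_trans (opnormP g x)); rewrite ler_piMr// dual_norm_ge0.
Qed.

Let dual_normZ_le (a : K) (f : dual) :
  dual_norm (a *: f) <= `|a| * dual_norm f.
Proof.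
rewrite -(to_realK (normr_ge0 a)) /dual_norm -of_realM ler_of_real.
apply: opnorm_le => x; rewrite !rnorm_leE of_real1 dualZ of_realM => x1.
rewrite normrZ to_realK// ler_wpM2l//.
by apply: (le_trans (opnormP f x)); rewrite ler_piMr// dual_norm_ge0.
Qed.

Let dual_normZ (a : K) (f : dual) : dual_norm (a *: f) = `|a| * dual_norm f.
Proof.
apply/le_anti; rewrite dual_normZ_le /=.
have [->|a0] := eqVneq a 0; first by rewrite normr0 mul0r dual_norm_ge0.
have := dual_normZ_le a^-1 (a *: f).
by rewrite scalerA mulVf// scale1r normfV ler_pdivlMl ?normr_gt0.
Qed.

Let dual_norm0_eq0 (f : dual) : dual_norm f = 0 -> f = 0.
Proof.
move=> f0; apply/val_inj/funext => x; apply/eqP; rewrite -normr_le0.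
by have := opnormP f x; rewrite -/(dual_norm f) f0 mul0r.
Qed.

HB.instance Definition _ :=
  Lmodule_isNormed.Build K dual dual_normD dual_normZ dual_norm0_eq0.

Lemma rnorm_dual (f : dual) : rnorm f = opnorm f.
Proof. exact: of_realK. Qed.

End dual.

Section sequences.
Context {R : realType} {k : scalar_kind}.
Local Notation K := (scalars R k).
Local Open Scope ereal_scope.

(* In all that follows the exponents p are meant to satisfy 0 < p <= +oo. *)

Definition lp_norm (F : normedModType K) (p : \bar R) (y : nat -> F) : \bar R :=
  Lnorm counting p (fun j => (rnorm (y j))%:E).

Definition in_lp (F : normedModType K) (p : \bar R) (y : nat -> F) : Prop :=
  lp_norm p y < +oo.

Definition in_weak_lp (E : normedModType K) (p : \bar R) (x : nat -> E) : Prop :=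
  forall phi : dual E, in_lp p (phi \o x).

Definition weak_lp_norm (E : normedModType K) (p : \bar R) (x : nat -> E)
    : \bar R :=
  ereal_sup
    [set lp_norm p (phi \o x) | phi in [set phi : dual E | (rnorm phi <= 1)%R]].

(* A finite family of length m, extended by zero to a sequence. *)
Definition trunc_seq (E : normedModType K) (m : nat) (x : nat -> E) : nat -> E :=
  fun j => if (j < m)%N then x j else 0%R.

End sequences.

Section multilinear.
Context {R : realType} {k : scalar_kind}.
Local Notation K := (scalars R k).
Context {I : finType} (E : I -> normedModType K) (F : normedModType K).
Local Open Scope ereal_scope.
Implicit Types (A : (forall i, E i) -> F) (p : \bar R) (ps : I -> \bar R).

Definition multilinear A : Prop :=
  forall (x : forall i, E i) (i : I), linear (fun u : E i => A (dfwith x i u)).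

(* The space of bounded, that is continuous, multilinear maps. *)
Definition bounded_multilinear : set ((forall i, E i) -> F) :=
  [set A | multilinear A /\ continuous (A : prod_topology E -> F)].

Definition induced A (x : forall i, nat -> E i) : nat -> F :=
  fun j => A (fun i => x i j).

(* The map induced by A sends the product of the weak l_(ps i)-spaces to l_p
   and is continuous for their (quasi-)norms. *)
Definition induced_bounded p ps A : Prop :=
  (forall x : forall i, nat -> E i,
     (forall i, in_weak_lp (ps i) (x i)) -> in_lp p (induced A x)) /\
  (forall x : forall i, nat -> E i, (forall i, in_weak_lp (ps i) (x i)) ->
   forall e : R, (0 < e)%R -> exists2 d : R, (0 < d)%R &
   forall y : forall i, nat -> E i, (forall i, in_weak_lp (ps i) (y i)) ->
     (forall i, weak_lp_norm (ps i) (fun j => y i j - x i j)%R < d%:E) ->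
     lp_norm p (fun j => induced A y j - induced A x j)%R < e%:E).

Definition absolutely_summing p ps A : Prop :=
  exists2 C : R, (0 < C)%R &
  forall (m : nat) (x : forall i, nat -> E i),
    lp_norm p (trunc_seq m (induced A x)) <=
    C%:E * \prod_(i in I) weak_lp_norm (ps i) (trunc_seq m (x i)).

Definition summing_maps p ps : set ((forall i, E i) -> F) :=
  [set A | bounded_multilinear A /\ absolutely_summing p ps A].

End multilinear.

Definition two_dominated (R : realType) (k : scalar_kind)
    (E : 'I_2 -> normedModType (scalars R k))
    (B : (forall i, E i) -> (scalars R k)^o) : Prop :=
  absolutely_summing 1%E (fun=> 2%:E)%E B.

Section Littlewood_Orlicz.
Context {R : realType} {k : scalar_kind}.
Local Notation K := (scalars R k).
Variable E : normedModType K.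
Local Open Scope ereal_scope.

(* The linear map sending sum_l a_l (x) z_l to the sequence
   j |-> sum_l a_l(j) z_l is injective on the algebraic tensor product of l_2
   and E, and also, l_2 having the approximation property, on its projective
   completion. Both spaces are represented below by their images in E^nat. *)

Definition represents (m : nat) (a : 'I_m -> nat -> K^o) (z : 'I_m -> E)
    (u : nat -> E) : Prop :=
  (forall l, in_lp 2%:E (a l)) /\
  forall j, u j = (\sum_(l < m) a l j *: z l)%R.

Definition algebraic_tensor (u : nat -> E) : Prop :=
  exists (m : nat) (a : 'I_m -> nat -> K^o) (z : 'I_m -> E), represents a z u.

Definition projective_norm (u : nat -> E) : \bar R :=
  ereal_inf [set s | exists (m : nat) (a : 'I_m -> nat -> K^o) (z : 'I_m -> E),
    represents a z u /\
    s = \sum_(l < m) lp_norm 2%:E (a l) * (rnorm (z l))%:E].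

(* x is (the sequence associated with) the limit, in the completion, of the
   Cauchy sequence v. *)
Definition projective_limit (v : nat -> nat -> E) (x : nat -> E) : Prop :=
  [/\ forall n, algebraic_tensor (v n),
      forall e : R, (0 < e)%R -> exists N, forall n m, (N <= n)%N -> (N <= m)%N ->
        projective_norm (fun j => v n j - v m j)%R < e%:E
    & forall j, v n j @[n --> \oo] --> x j].

Definition in_projective_tensor (x : nat -> E) : Prop :=
  exists v, projective_limit v x.

(* The norm of the completion: the limit below does not depend on v. *)
Definition projective_tensor_norm (x : nat -> E) : \bar R :=
  ereal_inf [set s | exists v, projective_limit v x /\
    projective_norm (v n) @[n --> \oo] --> s].

Definition Littlewood_Orlicz : Prop :=
  (forall x : nat -> E, in_weak_lp 1 x -> in_projective_tensor x) /\
  exists2 C : R, (0 < C)%R & forall x : nat -> E, in_weak_lp 1 x ->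
    projective_tensor_norm x <= C%:E * weak_lp_norm 1 x.

End Littlewood_Orlicz.

(* Main.v *)
Require Import Defs.
From HB Require Import structures.
From mathcomp Require Import all_boot all_order all_algebra.
From mathcomp Require Import all_classical all_reals all_analysis.
From mathcomp Require Import ring lra.
Import Order.TTheory GRing.Theory Num.Theory.
Import numFieldNormedType.Exports.

Set Implicit Arguments.
Unset Strict Implicit.
Unset Printing Implicit Defensive.

Local Open Scope classical_set_scope.
Local Open Scope ring_scope.

(* Weakly 2-summable sequences are fed into one coordinate after the other,
   the remaining coordinates being constant. For the first two coordinates
   the summability of A(x_j^1, x_j^2, z) is the hypothesis on bilinear forms.
   If the first i coordinates are done, then the forms
   phi_j = A(x_j^1, ..., x_j^i, ., z) on E_(i+1) satisfy
   sum_j |phi_j(u)| < oo for each u, and by uniform boundedness (phi_j) is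
   weakly summable in the dual of E_(i+1). By the Littlewood-Orlicz property
   it belongs to the projective tensor product of l_2 with this dual, hence
   pairs with weakly 2-summable sequences of E_(i+1) into l_1. All estimates are
   made on finite families, with a constant that does not depend on them. *)

(** * Norms with real values, and linear forms *)

Section real_norm.
Context {R : realType} {k : scalar_kind}.
Local Notation K := (scalars R k).

Lemma ltr_of_real (x y : R) : (of_real k x < of_real k y) = (x < y).
Proof. by rewrite !lt_neqAle ler_of_real (can_eq of_realK). Qed.

Lemma of_real_ge0 (x : R) : (0 <= of_real k x) = (0 <= x).
Proof. by rewrite -(@of_real0 R k) ler_of_real. Qed.

Lemma of_real_gt0 (x : R) : (0 < of_real k x) = (0 < x).
Proof. by rewrite -(@of_real0 R k) ltr_of_real. Qed.

Section normed.
Context {V : normedModType K}.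
Implicit Types x y : V.

Lemma rnorm_ge0 x : 0 <= rnorm x.
Proof. by rewrite -of_real_ge0 of_real_rnorm. Qed.

Lemma rnorm0 : rnorm (0 : V) = 0.
Proof. by apply: (can_inj (@of_realK R k)); rewrite of_real_rnorm normr0 of_real0. Qed.

Lemma rnormD x y : rnorm (x + y) <= rnorm x + rnorm y.
Proof. by rewrite rnorm_leE of_realD !of_real_rnorm ler_normD. Qed.

Lemma rnormN x : rnorm (- x) = rnorm x.
Proof. by rewrite /rnorm normrN. Qed.

Lemma rnormB x y : rnorm (x - y) = rnorm (y - x).
Proof. by rewrite /rnorm distrC. Qed.

Lemma rnormZ (a : K) x : rnorm (a *: x) = rnorm (a : K^o) * rnorm x.
Proof.
by apply: (can_inj (@of_realK R k)); rewrite of_realM !of_real_rnorm normrZ.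
Qed.

Lemma rnorm_sum (I : Type) (r : seq I) (P : pred I) (u : I -> V) :
  rnorm (\sum_(i <- r | P i) u i) <= \sum_(i <- r | P i) rnorm (u i).
Proof.
elim/big_rec2: _ => [|i s t _ st]; first by rewrite rnorm0.
by apply: (le_trans (rnormD _ _)); rewrite lerD2l.
Qed.

Lemma cvg_rnormP {T : Type} {F : set_system T} {FF : Filter F} (f : T -> V)
    (l : V) :
  f @ F --> l <-> forall e : R, 0 < e -> \forall t \near F, rnorm (l - f t) < e.
Proof.
split=> [/cvgrPdist_lt fl e e0|fl].
  have := fl (of_real k e); rewrite of_real_gt0 => /(_ e0).
  by apply: filterS => t; rewrite -of_real_rnorm ltr_of_real.
apply/cvgrPdist_lt => e e0.
have eE := to_realK (ltW e0).
have e0' : 0 < to_real e by rewrite -of_real_gt0 eE.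
by apply: filterS (fl _ e0') => t; rewrite -ltr_of_real eE of_real_rnorm.
Qed.

End normed.

Lemma rnormM (a b : K) : rnorm (a * b : K^o) = rnorm (a : K^o) * rnorm (b : K^o).
Proof. exact: (@rnormZ K^o a b). Qed.

Lemma rnorm_of_real (r : R) : 0 <= r -> rnorm (of_real k r : K^o) = r.
Proof.
move=> r0; apply: (can_inj (@of_realK R k)).
by rewrite of_real_rnorm ger0_norm// of_real_ge0.
Qed.

(** Multiplying by such factors turns a sum of absolute values into a single linear combination,
    which the norm of a form then controls. *)
Lemma phase_ex (z : K) : exists2 e : K, rnorm (e : K^o) <= 1 &
  e * z = of_real k (rnorm (z : K^o)).
Proof.
have [->|z0] := eqVneq z 0.
  by exists 0; rewrite ?mulr0 rnorm0 ?of_real0.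
exists (`|z| / z); last by rewrite divfK// of_real_rnorm.
by rewrite rnorm_leE of_real1 normrM normfV normr_id mulfV ?normr_eq0.
Qed.

End real_norm.

Section dual_facts.
Context {R : realType} {k : scalar_kind}.
Local Notation K := (scalars R k).
Context {E : normedModType K}.
Implicit Types (f g : dual E) (x y : E).

Lemma dual_form_linear f :
  exists L : {linear E -> K^o}, forall x, f x = L x.
Proof.
pose L : {linear E -> K^o} :=
  HB.pack (f : E -> K^o) (GRing.isLinear.Build _ _ _ _ _ (dual_linear f)).
by exists L.
Qed.

Lemma dual_addE f x y : f (x + y) = f x + f y.
Proof. by have [L LE] := dual_form_linear f; rewrite !LE linearD. Qed.

Lemma dual_subE f x y : f (x - y) = f x - f y.
Proof. by have [L LE] := dual_form_linear f; rewrite !LE linearB. Qed.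

Lemma dual_scaleE f (a : K) x : f (a *: x) = a * f x.
Proof. by have [L LE] := dual_form_linear f; rewrite !LE linearZ. Qed.

Lemma dual_sum (I : Type) (r : seq I) (P : pred I) (f_ : I -> dual E) x :
  (\sum_(i <- r | P i) f_ i) x = \sum_(i <- r | P i) f_ i x.
Proof. by elim/big_rec2: _ => // i s t _ <-. Qed.

Lemma dual_sub f g x : (f - g) x = f x - g x.
Proof. by []. Qed.

Lemma dual_form_sum f (I : Type) (r : seq I) (P : pred I) (u : I -> E) :
  f (\sum_(i <- r | P i) u i) = \sum_(i <- r | P i) f (u i).
Proof.
have [L LE] := dual_form_linear f; rewrite LE linear_sum.
by apply: eq_bigr => i _; rewrite LE.
Qed.

Lemma rnorm_dual_le f x : rnorm (f x) <= rnorm f * rnorm x.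
Proof. by rewrite rnorm_leE of_realM rnorm_dual of_real_rnorm opnormP. Qed.

Lemma dual_bounded_ex (L : E -> K^o) (M : R) : linear L ->
  (forall x, rnorm (L x) <= M * rnorm x) ->
  exists f : dual E, (f : E -> K^o) = L.
Proof.
move=> lL bL.
have Lin : L \in @continuous_linear_form R k E.
  rewrite inE; split => // x.
  have LB y : L x - L y = L (x - y).
    have := lL (-1) y x; rewrite !scaleN1r (addrC (- y)) => ->.
    by rewrite addrC.
  apply/cvg_rnormP => e e0.
  (* [M] may be zero or negative, so the quotient is taken by a positive majorant. *)
  have M0 : 0 < `|M| + 1 by apply: ltr_wpDl.
  have /cvg_rnormP/(_ (e / (`|M| + 1))) : (y @[y --> x] --> x) by exact: cvg_id.
  rewrite divr_gt0// => /(_ isT); apply: filterS => y.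
  rewrite LB ltr_pdivlMr// => xy; apply: le_lt_trans xy.
  apply: (le_trans (bL _)); rewrite mulrC ler_wpM2l ?rnorm_ge0//.
  by rewrite (le_trans (ler_norm M))// lerDl.
by exists (Dual Lin).
Qed.

Lemma rnorm_dual_bound f (M : R) : 0 <= M ->
  (forall x, rnorm (f x) <= M * rnorm x) -> rnorm f <= M.
Proof.
move=> M0 fM; rewrite rnorm_dual; apply: opnorm_le => x x1.
by apply: (le_trans (fM x)); rewrite ler_piMr.
Qed.

End dual_facts.

Section evaluation.
Context {R : realType} {k : scalar_kind}.
Local Notation K := (scalars R k).
Context {E : normedModType K}.

(** The canonical embedding into the bidual makes uniform boundedness applicable to vectors of [E],
    seen as forms on the dual. *)
Lemma evaluation_ex (x : E) : exists F : dual (dual E), forall f, F f = f x.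
Proof.
have [||F FE] := @dual_bounded_ex R k (dual E) (fun f => f x) (rnorm x).
- by move=> a f g; rewrite dualD dualZ.
- by move=> f; rewrite mulrC rnorm_dual_le.
by exists F => f; rewrite FE.
Qed.

End evaluation.

(** * Completeness of the dual *)

Section dual_complete.
Context {R : realType} {k : scalar_kind}.
Local Notation K := (scalars R k).

Lemma cauchy_rnormP {V : normedModType K} (F : set_system V) {FF : Filter F} :
  cauchy F <->
  forall e : R, 0 < e -> \forall x & y \near F, rnorm (x - y) < e.
Proof.
split=> [/cauchy_ballP Fc e e0|Fc].
  have := Fc (of_real k e); rewrite of_real_gt0 => /(_ e0).
  apply: filterS => -[x y].
  by rewrite /= -ball_normE /ball_ /= -of_real_rnorm ltr_of_real.
apply/cauchy_ballP => e e0.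
have eE := to_realK (ltW e0).
have e0' : 0 < to_real e by rewrite -(@of_real_gt0 R k) eE.
apply: filterS (Fc _ e0') => -[x y] /=.
by rewrite -ball_normE /ball_ /= -(ltr_of_real (k := k)) eE of_real_rnorm.
Qed.

Variable E : completeNormedModType K.

(* The scalar field is not known to be complete: the values [f x] are embedded
   in [E] as the vectors [f x *: x], and their limit is read off by a form that
   does not vanish at [x]. *)
Lemma dual_pointwise_cvg (F : set_system (dual E)) {FF : ProperFilter F} :
  cauchy F -> forall x : E, cvg ((fun f : dual E => f x : K^o) @ F).
Proof.
move=> /cauchy_rnormP Fc x.
have [[g gx]|gx0] := pselect (exists g : dual E, g x != 0); last first.
  apply/cvg_ex; exists 0; apply/cvg_rnormP => e e0; apply: filterE => f.
  have -> : f x = 0 by apply/eqP/negPn/negP => fx; apply: gx0; exists f.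
  by rewrite subr0 rnorm0.
have : cvg ((fun f : dual E => f x *: x) @ F).
  apply: cauchy_cvg; apply/cauchy_rnormP => e e0.
  have M0 : 0 < rnorm x * rnorm x + 1 by rewrite ltr_wpDl// mulr_ge0// rnorm_ge0.
  have {Fc}: \forall f & h \near F, rnorm ((f : dual E) x *: x - (h : dual E) x *: x) < e.
    apply: filterS (Fc (e / (rnorm x * rnorm x + 1)) _); last exact: divr_gt0.
    move=> -[f h] /=; rewrite ltr_pdivlMr// => fh.
    rewrite -scalerBl -dual_sub rnormZ; apply: le_lt_trans fh.
    apply: (@le_trans _ _ (rnorm (f - h) * rnorm x * rnorm x)).
      by apply: ler_wpM2r; rewrite ?rnorm_ge0// rnorm_dual_le.
    by rewrite -mulrA ler_wpM2l ?rnorm_ge0// lerDl.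
  case=> -[A B] /= [FA FB] AB.
  exists ((fun f : dual E => f x *: x) @` A, (fun f : dual E => f x *: x) @` B).
    split => /=.
      by apply: filterS FA => f; exists f.
    by apply: filterS FB => f; exists f.
  by move=> -[_ _] [/= [f Af <-] [h Bh <-]]; apply: (AB (f, h)).
move=> /cvg_ex[y xy]; apply/cvg_ex; exists (g y / g x).
have -> : (fun f : dual E => f x : K^o) = (fun f : dual E => g (f x *: x) / g x).
  by apply/funext => f; rewrite dual_scaleE mulfK.
apply: (@cvgMr_tmp _ _ F _ (fun f : dual E => g (f x *: x) : K^o)).
apply: (cvg_comp _ _ xy); exact: dual_continuous.
Qed.

(** A Cauchy filter converges pointwise to a form [L]; letting one member of a Cauchy pair tend to
    the limit makes the convergence uniform on the unit ball. Completeness of the dual permits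
    uniform boundedness for forms on it. *)
Lemma dual_complete (F : set_system (dual E)) : ProperFilter F -> cauchy F ->
  cvg F.
Proof.
move=> FF Fc.
have /choice[L FL] : forall x, exists l, (fun f : dual E => f x : K^o) @ F --> (l : K^o).
  by move=> x; apply/cvg_ex; exact: dual_pointwise_cvg.
have lL : linear (L : E -> K^o).
  move=> a x y; apply: (@cvg_unique _ (@norm_hausdorff _ K^o)
    ((fun f : dual E => f (a *: x + y) : K^o) @ F)); first exact: FL.
  have -> : (fun f : dual E => f (a *: x + y) : K^o) =
      (fun f : dual E => a *: (f x : K^o) + (f y : K^o)).
    by apply/funext => f; rewrite dual_linear.
  rewrite /=; apply: (@cvgD _ K^o _ F _ (fun f : dual E => a *: (f x : K^o))
    (fun f : dual E => f y : K^o)) => //.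
  exact: (@cvgZl_tmp _ K^o _ F _ a (fun f : dual E => f x : K^o)).
have near_limit e : 0 < e ->
    \forall f \near F, forall x, rnorm (L x - (f : dual E) x : K^o) <= e * rnorm x.
  move=> e0; move/cauchy_rnormP : Fc => /(_ _ e0)[[A B] /= [FA FB] AB].
  apply: filterS FA => f Af x; apply/ler_addgt0Pl => d d0.
  (* [h] is chosen after [x], close to the limit at [x]; its contribution [d] is arbitrary, and the
     condition on [f] is independent of [x]. *)
  near F => h.
  have fh : rnorm (f - h) < e.
    by apply: (AB (f, h)); split => //=; near: h.
  rewrite (_ : L x - f x = (L x - h x) - (f x - h x)); last by rewrite opprB addrA subrK.
  apply: (le_trans (rnormD _ _)); rewrite rnormN lerD//.
    by apply: ltW; near: h; move: d d0; apply/cvg_rnormP; exact: FL.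
  rewrite -dual_sub; apply: (le_trans (rnorm_dual_le _ _)).
  by rewrite ler_wpM2r ?rnorm_ge0// ltW.
have [g gL] : exists g : dual E, (g : E -> K^o) = L.
  (* A single [f] at distance at most 1 from [L] shows that [L] is bounded. *)
  have [f fL] := @filter_ex _ F _ _ (near_limit 1 ltr01).
  apply: (@dual_bounded_ex R k E L (1 + rnorm f)) => // x.
  rewrite -[L x](subrK (f x)) mulrDl; apply: (le_trans (rnormD _ _)).
  by rewrite lerD// rnorm_dual_le.
apply/cvg_ex; exists g; apply/cvg_rnormP => e e0.
apply: filterS (near_limit (e / 2) _); last exact: divr_gt0.
move=> f fL; apply: (@le_lt_trans _ _ (e / 2)).
  apply: rnorm_dual_bound => [|x]; first by rewrite ltW// divr_gt0.
  by rewrite dual_sub gL.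
by rewrite ltr_pdivrMr// mulr_natr mulr2n ltrDl.
Unshelve. all: by end_near. Qed.

HB.instance Definition _ := Uniform_isComplete.Build (dual E) dual_complete.

End dual_complete.

(** * Uniform boundedness *)

Section banach_steinhaus.
Context {R : realType} {k : scalar_kind}.
Local Notation K := (scalars R k).

(** The factor [3 / 2] is the sum of the geometric series of ratio [3^-1]. *)
Lemma geometric_cvg (V : completeNormedModType K) (u : nat -> V) (q := 3^-1 : R) :
  (forall n, rnorm (u n.+1 - u n) <= q ^+ n) ->
  exists l, forall n, rnorm (l - u n) <= 3 / 2 * q ^+ n.
Proof.
move=> uq.
have q0 n : 0 < q ^+ n by rewrite exprn_gt0// invr_gt0.
(* Keeping the exact partial sum, with its negative term, lets the induction on [p] close. *)
have dist_u n p : rnorm (u (n + p)%N - u n) <= 3 / 2 * (q ^+ n - q ^+ (n + p)).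
  elim: p => [|p IH]; first by rewrite addn0 !subrr rnorm0 mulr0.
  rewrite addnS -[_ - u n](subrKA (u (n + p)%N)).
  apply: (le_trans (rnormD _ _)); apply: (le_trans (lerD (uq _) IH)).
  rewrite exprS /q; set a := 3^-1 ^+ (n + p); set b := 3^-1 ^+ n.
  lra.
have dist_le n p : (n <= p)%N -> rnorm (u p - u n) <= 3 / 2 * q ^+ n.
  move=> np; rewrite -(subnKC np); apply: (le_trans (dist_u _ _)).
  by rewrite ler_pM2l ?divr_gt0// gerBl ltW.
have q_small (e : R) : 0 < e -> \forall n \near \oo, 3 / 2 * q ^+ n < e.
  move=> e0; have : (3 / 2 * q ^+ n @[n --> \oo] --> 3 / 2 * (0 : R))%R.
    by apply: cvgMl_tmp; apply: cvg_expr; rewrite ger0_norm /q ?invr_ge0//; lra.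
  rewrite mulr0 => /cvgrPdist_lt/(_ _ e0); apply: filterS => n.
  by rewrite sub0r normrN ger0_norm// mulr_ge0// ltW.
have : cvg (u @ \oo).
  apply: cauchy_cvg; apply/cauchy_rnormP => e e0.
  have e2 : 0 < e / 2 by rewrite divr_gt0.
  have [N _ Ne] := q_small _ e2.
  exists (u @` [set n | (N <= n)%N], u @` [set n | (N <= n)%N]).
    by split; exists N => // n Nn; exists n.
  move=> -[_ _] [/= [n Nn <-] [p Np <-]].
  rewrite -[u n - u p](subrKA (u N)); apply: (le_lt_trans (rnormD _ _)).
  rewrite [rnorm (u N - _)]rnormB (splitr e).
  have {}Ne := Ne N (leqnn N).
  by apply: ltrD; apply: le_lt_trans Ne; exact: dist_le.
move=> /cvg_ex[l ul]; exists l => n; apply/ler_addgt0Pl => d d0.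
move/cvg_rnormP : ul => /(_ _ d0)[N _ uN].
rewrite -[l - u n](subrKA (u (maxn N n))).
apply: (le_trans (rnormD _ _)); apply: lerD.
  by apply: ltW; apply: uN; exact: leq_maxl.
exact/dist_le/leq_maxr.
Qed.

(** The supremum defining the norm need not be attained; among the factors below 1, [2 / 3] exceeds
    the [1 / 2] that is lost later in passing to the limit point. *)
Lemma dual_almost_norming (V : normedModType K) (f : dual V) :
  exists2 x, rnorm x <= 1 & 2 / 3 * rnorm f <= rnorm (f x).
Proof.
have [f0|f0] := leP (rnorm f) 0.
  exists 0; first by rewrite rnorm0.
  by apply: (@le_trans _ _ 0); [rewrite pmulr_rle0 ?divr_gt0|exact: rnorm_ge0].
have e0 : 0 < 3^-1 * rnorm f by rewrite mulr_gt0// invr_gt0.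
have [_ [x x1 <-]] := sup_adherent e0 (opnorm_has_sup f).
rewrite -/(opnorm f) -rnorm_dual => fx; exists x => //.
apply: ltW; apply: le_lt_trans fx; lra.
Qed.

(* The midpoint of [x + r u] and [x - r u] being [x], one of these two points
   makes [f] at least as large as at [r u]. *)
Lemma dual_large_nearby (V : normedModType K) (f : dual V) (x : V) (r : R) :
  0 < r ->
  exists2 y, rnorm (y - x) <= r & 2 / 3 * r * rnorm f <= rnorm (f y).
Proof.
move=> r0; have [u u1 fu] := dual_almost_norming f.
pose v := of_real k r *: u.
have vr : rnorm v <= r.
  by rewrite rnormZ rnorm_of_real ?(ltW r0)// ler_piMr// ltW.
have fv : 2 / 3 * r * rnorm f <= rnorm (f v).
  rewrite dual_scaleE rnormM rnorm_of_real ?(ltW r0)//.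
  by have := ler_wpM2l (ltW r0) fu; lra.
have [h|h] := leP (2 / 3 * r * rnorm f) (rnorm (f (x + v))).
  by exists (x + v) => //; rewrite addrC addKr.
exists (x - v); first by rewrite addrC addKr rnormN.
have := @rnormD R k K^o (f (x + v)) (- f (x - v)).
rewrite rnormN -dual_subE (_ : x + v - (x - v) = v + v); last first.
  by rewrite opprB addrC subrKA.
have -> : f (v + v) = of_real k (1 + 1) * f v.
  by rewrite dual_addE of_realD of_real1 mulrDl mul1r.
rewrite rnormM rnorm_of_real ?addr_ge0//.
lra.
Qed.

(* Sokal's argument: the points [x n] move by at most [3^-n], whereas [f n] is
   of the order of [n] at [x n.+1], and still at the limit. *)
Theorem dual_banach_steinhaus (V : completeNormedModType K) (F : set (dual V)) :
  (forall x, exists M, forall f, F f -> rnorm (f x) <= M) ->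
  exists M, forall f, F f -> rnorm f <= M.
Proof.
move=> Fpb; apply: contrapT => Funb.
(* The limit point lies within [3 / 2 * 3^-(n+1)], that is [3^-n / 2], of [x n.+1], where [f n] is
   at least [2 / 3 * 3^-n] times its norm. The difference [1 / 6] accounts for the factor 6. *)
have /choice[f Ff] n : exists f, F f /\ 6 * 3 ^+ n * n%:R < rnorm f.
  apply: contrapT => nf; apply: Funb; exists (6 * 3 ^+ n * n%:R) => f Ff.
  by rewrite leNgt; apply/negP => fn; apply: nf; exists f.
pose q : R := 3^-1.
have q0 n : 0 < q ^+ n by rewrite exprn_gt0// invr_gt0.
have /choice[y yP] (nx : nat * V) : exists y : V,
    rnorm (y - nx.2) <= q ^+ nx.1 /\
    2 / 3 * q ^+ nx.1 * rnorm (f nx.1) <= rnorm (f nx.1 y).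
  by have [y] := dual_large_nearby (f nx.1) nx.2 (q0 nx.1); exists y.
pose fix x n := if n is m.+1 then y (m, x m) else 0 : V.
have [l xl] : exists l, forall n, rnorm (l - x n) <= 3 / 2 * q ^+ n.
  by apply: geometric_cvg => n; have [] := yP (n, x n).
have [M FM] := Fpb l.
have fl n : n%:R <= rnorm (f n l).
  have /= [_ large] := yP (n, x n); have [_ fn] := Ff n.
  have := @rnormD R k K^o (f n l) (- f n (l - x n.+1)).
  rewrite rnormN -dual_subE opprB addrCA subrr addr0 => tri.
  have near_l := le_trans (rnorm_dual_le (f n) (l - x n.+1))
    (ler_wpM2l (rnorm_ge0 (f n)) (xl n.+1)).
  have qf : 6 * n%:R <= q ^+ n * rnorm (f n).
    have q3 : q ^+ n * 3 ^+ n = 1 by rewrite -exprMn mulVf ?expr1n// pnatr_eq0.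
    rewrite (_ : 6 * n%:R = q ^+ n * (6 * 3 ^+ n * n%:R)); last first.
      by transitivity (6 * n%:R * (q ^+ n * 3 ^+ n)); [rewrite q3 mulr1|ring].
    by rewrite ler_pM2l// ltW.
  move: large tri qf near_l; rewrite (_ : q ^+ n.+1 = 3^-1 * q ^+ n) ?exprS//.
  rewrite -/(x n.+1).
  set a := q ^+ n; set b := rnorm (f n) => large tri qf near_l; lra.
have := FM _ (Ff (Num.truncn M).+1).1; apply/negP; rewrite -ltNge.
exact: lt_le_trans (truncnS_gt M) (fl _).
Qed.

End banach_steinhaus.

(** * Weak sequence norms *)

Section finite_sums.
Context {R : realType}.

(** Replaces extended-real series by finite real sums, in which the later estimates are made. *)
Lemma nneseries_leP (a : nat -> R) (M : R) : (forall j, 0 <= a j) ->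
  (\sum_(0 <= j <oo) (a j)%:E <= M%:E)%E <-> forall m, \sum_(j < m) a j <= M.
Proof.
move=> a0; split=> [aM m|aM].
  rewrite -lee_fin -sumEFin; apply: le_trans aM.
  rewrite -(big_mkord xpredT (fun j => (a j)%:E)).
  by apply: nneseries_lim_ge => j _ _; rewrite lee_fin.
apply: lime_le; first by apply: is_cvg_nneseries => j _ _; rewrite lee_fin.
by apply: nearW => m; rewrite big_mkord sumEFin lee_fin.
Qed.

Lemma sum_trunc_leP (a b : nat -> R) (m : nat) (M : R) : (forall j, 0 <= a j) ->
  (forall j, b j = if (j < m)%N then a j else 0) ->
  (forall p, \sum_(j < p) b j <= M) <-> \sum_(j < m) a j <= M.
Proof.
move=> a0 bE; split=> [/(_ m)|aM p].
  by congr (_ <= _); apply: eq_bigr => j _; rewrite bE ltn_ord.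
apply: le_trans aM; rewrite -!(big_mkord xpredT) /=.
have [mp|/ltnW pm] := leqP m p.
  rewrite (big_cat_nat (leq0n m) mp)/=.
  rewrite (@eq_big_nat _ _ _ 0%N m b a); last by move=> j /andP[_ jm]; rewrite bE jm.
  rewrite [X in _ + X]big_nat [X in _ + X]big1 ?addr0// => j /andP[mj _].
  by rewrite bE ltnNge mj.
rewrite [leRHS](big_cat_nat (leq0n p) pm)//= -[leLHS]addr0 lerD ?sumr_ge0//.
by apply: ler_sum => j _; rewrite bE; case: ifP.
Qed.

(** Induction on the list: on the tail, [A] and [B] become the square roots of its sums of squares,
    and the step is the inequality in the plane. *)
Lemma cauchy_schwarz_sum (I : Type) (r : seq I) (a b : I -> R) (A B : R) :
  0 <= A -> 0 <= B -> \sum_(i <- r) a i ^+ 2 <= A ^+ 2 ->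
  \sum_(i <- r) b i ^+ 2 <= B ^+ 2 -> \sum_(i <- r) a i * b i <= A * B.
Proof.
elim: r A B => [|i r IH] A B A0 B0; first by rewrite !big_nil => _ _; exact: mulr_ge0.
rewrite !big_cons => aA bB.
pose S (c : I -> R) := \sum_(j <- r) c j ^+ 2.
have S0 c : 0 <= S c by apply: sumr_ge0 => j _; exact: sqr_ge0.
have := IH (Num.sqrt (S a)) (Num.sqrt (S b)) (sqrtr_ge0 _) (sqrtr_ge0 _).
rewrite !sqr_sqrtr// => /(_ (lexx _) (lexx _)).
have := sqr_sqrtr (S0 a); have := sqr_sqrtr (S0 b).
have := sqrtr_ge0 (S a); have := sqrtr_ge0 (S b).
rewrite -/(S a) -/(S b) in aA bB.
set p := Num.sqrt (S a); set q := Num.sqrt (S b) => q0 p0 qE pE.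
rewrite -qE in bB; rewrite -pE in aA; move: (a i) (b i) aA bB => x y aA bB IHr.
apply: (@le_trans _ _ (x * y + p * q)); first by rewrite lerD2l.
(* Squaring preserves the order only between nonnegative numbers. *)
have [neg|pos] := ltP (x * y + p * q) 0.
  by apply: le_trans (ltW neg) _; exact: mulr_ge0.
rewrite -(@ler_pXn2r _ 2)// ?nnegrE ?mulr_ge0// [leRHS]exprMn.
apply: (@le_trans _ _ ((x ^+ 2 + p ^+ 2) * (y ^+ 2 + q ^+ 2))); last first.
  by apply: ler_pM => //; rewrite addr_ge0// sqr_ge0.
(* Lagrange's identity. *)
rewrite -subr_ge0 (_ : _ - _ = (x * q - p * y) ^+ 2) ?sqr_ge0//; ring.
Qed.

End finite_sums.

Section lp_norms.
Context {R : realType} {k : scalar_kind}.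
Local Notation K := (scalars R k).
Context {F : normedModType K}.

Lemma lp_norm1_leP (y : nat -> F) (M : R) :
  (lp_norm 1 y <= M%:E)%E <-> forall m, \sum_(j < m) rnorm (y j) <= M.
Proof.
apply: iff_trans (nneseries_leP M (fun j => rnorm_ge0 (y j))).
rewrite /lp_norm Lnorm1 ge0_integral_count; last by move=> j; exact: abse_ge0.
rewrite (@eq_eseriesr _ _ (fun j => (rnorm (y j))%:E))// => j _.
by rewrite gee0_abs// lee_fin rnorm_ge0.
Qed.

Lemma lp_norm2_leP (y : nat -> F) (M : R) : 0 <= M ->
  (lp_norm 2%:E y <= M%:E)%E <-> forall m, \sum_(j < m) rnorm (y j) ^+ 2 <= M ^+ 2.
Proof.
move=> M0; apply: iff_trans (nneseries_leP (M ^+ 2) (fun j => sqr_ge0 (rnorm (y j)))).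
rewrite /lp_norm Lnorm_counting//.
rewrite (@eq_eseriesr _ _ (fun j => (rnorm (y j) ^+ 2)%:E)); last first.
  by move=> j _; rewrite gee0_abs ?lee_fin ?rnorm_ge0// poweR_EFin powR_mulrn ?rnorm_ge0.
set S := (\sum_(0 <= j <oo) _)%E.
have S0 : (0 <= S)%E by apply: nneseries_ge0 => j _ _; rewrite lee_fin sqr_ge0.
rewrite poweR12_sqrt//; case: S S0 => [s| |]//= s0.
by rewrite !lee_fin -ler_sqr ?nnegrE ?sqrtr_ge0// sqr_sqrtr.
Qed.

Lemma rnorm_trunc_seq (m : nat) (y : nat -> F) j :
  rnorm (trunc_seq m y j) = if (j < m)%N then rnorm (y j) else 0.
Proof. by rewrite /trunc_seq; case: ifP => //; rewrite rnorm0. Qed.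

Lemma lp_norm1_trunc_leP (m : nat) (y : nat -> F) (M : R) :
  (lp_norm 1 (trunc_seq m y) <= M%:E)%E <-> \sum_(j < m) rnorm (y j) <= M.
Proof.
apply: iff_trans (lp_norm1_leP _ _) _.
apply: (@sum_trunc_leP R (fun j => rnorm (y j))
  (fun j => rnorm (trunc_seq m y j))) => j; first exact: rnorm_ge0.
by rewrite rnorm_trunc_seq.
Qed.

Lemma lp_norm2_trunc_leP (m : nat) (y : nat -> F) (M : R) : 0 <= M ->
  (lp_norm 2%:E (trunc_seq m y) <= M%:E)%E <->
  \sum_(j < m) rnorm (y j) ^+ 2 <= M ^+ 2.
Proof.
move=> M0; apply: iff_trans (lp_norm2_leP _ M0) _.
apply: (@sum_trunc_leP R (fun j => rnorm (y j) ^+ 2)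
  (fun j => rnorm (trunc_seq m y j) ^+ 2)) => j; first exact: sqr_ge0.
by rewrite rnorm_trunc_seq; case: ifP => //; rewrite expr0n.
Qed.

End lp_norms.

Section weak_norms.
Context {R : realType} {k : scalar_kind}.
Local Notation K := (scalars R k).
Context {E : normedModType K}.

Lemma weak_lp_norm_leP (p M : \bar R) (x : nat -> E) :
  (weak_lp_norm p x <= M)%E <->
  forall phi : dual E, rnorm phi <= 1 -> (lp_norm p (phi \o x) <= M)%E.
Proof.
split=> [xM phi phi1|xM].
  by apply: le_trans xM; apply: ereal_sup_ubound; exists phi.
by apply: ge_ereal_sup => _ [phi phi1 <-]; exact: xM.
Qed.

Lemma weak_lp_norm_ge0 p (x : nat -> E) : (0 <= weak_lp_norm p x)%E.
Proof.
apply: (@le_trans _ _ (lp_norm p ((0 : dual E) \o x))); first exact: Lnorm_ge0.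
by apply: (weak_lp_norm_leP p _ x).1 => //; rewrite rnorm0.
Qed.

(** Turns bounds over the unit ball into bounds homogeneous in [phi]; a form of norm 0, which cannot
    be normalized, is served by [psi = 0]. *)
Lemma dual_normalize (phi : dual E) : exists2 psi : dual E, rnorm psi <= 1 &
  forall x, rnorm (phi x) = rnorm phi * rnorm (psi x).
Proof.
have [phi0|phi0] := eqVneq (rnorm phi) 0.
  exists 0; first by rewrite rnorm0.
  move=> x; rewrite phi0 mul0r; apply/le_anti; rewrite rnorm_ge0 andbT.
  by apply: (le_trans (rnorm_dual_le _ _)); rewrite phi0 mul0r.
have i0 : 0 <= (rnorm phi)^-1 by rewrite invr_ge0 rnorm_ge0.
exists (of_real k (rnorm phi)^-1 *: phi).
  by rewrite rnormZ rnorm_of_real// mulVf.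
move=> x; rewrite dualZ.
have -> : of_real k (rnorm phi)^-1 *: phi x = of_real k (rnorm phi)^-1 * phi x by [].
by rewrite rnormM rnorm_of_real// mulrA mulfV// mul1r.
Qed.

Lemma weak_l1_norm_leP (x : nat -> E) (M : R) : 0 <= M ->
  (weak_lp_norm 1 x <= M%:E)%E <->
  forall (phi : dual E) m, \sum_(j < m) rnorm (phi (x j)) <= rnorm phi * M.
Proof.
move=> M0; rewrite weak_lp_norm_leP; split=> xM phi.
  move=> m; have [psi psi1 phiE] := dual_normalize phi.
  under eq_bigr do rewrite phiE.
  rewrite -mulr_sumr ler_wpM2l ?rnorm_ge0//.
  by have /lp_norm1_leP := xM psi psi1.
move=> phi1; apply/lp_norm1_leP => m; apply: (le_trans (xM phi m)).
by rewrite ler_piMl.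
Qed.

Lemma weak_l2_norm_leP (x : nat -> E) (M : R) : 0 <= M ->
  (weak_lp_norm 2%:E x <= M%:E)%E <->
  forall (phi : dual E) m,
    \sum_(j < m) rnorm (phi (x j)) ^+ 2 <= (rnorm phi * M) ^+ 2.
Proof.
move=> M0; rewrite weak_lp_norm_leP; split=> xM phi.
  move=> m; have [psi psi1 phiE] := dual_normalize phi.
  under eq_bigr do rewrite phiE exprMn.
  rewrite -mulr_sumr exprMn ler_wpM2l ?sqr_ge0//.
  by have /lp_norm2_leP := xM psi psi1; exact.
move=> phi1; apply/lp_norm2_leP => // m; apply: (le_trans (xM phi m)).
by rewrite ler_pXn2r ?nnegrE ?mulr_ge0 ?rnorm_ge0// ler_piMl.
Qed.

Lemma dual_trunc_seq (phi : dual E) (m : nat) (x : nat -> E) :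
  phi \o trunc_seq m x = trunc_seq m (phi \o x : nat -> K^o).
Proof.
apply/funext => j; rewrite /trunc_seq /=; case: ifP => // _.
by rewrite -(subrr (0 : E)) dual_subE subrr.
Qed.

Lemma weak_l1_norm_trunc_leP (m : nat) (x : nat -> E) (M : R) :
  (weak_lp_norm 1 (trunc_seq m x) <= M%:E)%E <->
  forall phi : dual E, rnorm phi <= 1 -> \sum_(j < m) rnorm (phi (x j)) <= M.
Proof.
rewrite weak_lp_norm_leP; split=> xM phi /xM; rewrite dual_trunc_seq.
  by move/lp_norm1_trunc_leP.
by move=> ?; apply/lp_norm1_trunc_leP.
Qed.

Lemma weak_l2_norm_trunc_leP (m : nat) (x : nat -> E) (M : R) : 0 <= M ->
  (weak_lp_norm 2%:E (trunc_seq m x) <= M%:E)%E <->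
  forall phi : dual E, rnorm phi <= 1 ->
    \sum_(j < m) rnorm (phi (x j)) ^+ 2 <= M ^+ 2.
Proof.
move=> M0; rewrite weak_lp_norm_leP; split=> xM phi /xM; rewrite dual_trunc_seq.
  by move/lp_norm2_trunc_leP; exact.
by move=> ?; apply/lp_norm2_trunc_leP.
Qed.

(** A finite family has a finite weak norm, so [fine] loses nothing and products of norms can be
    taken in [R]. *)
Definition weak_l2_trunc (m : nat) (x : nat -> E) : R :=
  fine (weak_lp_norm 2%:E (trunc_seq m x)).

Lemma weak_l2_trunc_ge0 m x : 0 <= weak_l2_trunc m x.
Proof. by rewrite fine_ge0// weak_lp_norm_ge0. Qed.

Lemma weak_l2_truncE m x :
  weak_lp_norm 2%:E (trunc_seq m x) = (weak_l2_trunc m x)%:E.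
Proof.
rewrite fineK// ge0_fin_numE ?weak_lp_norm_ge0//.
pose s := \sum_(j < m) rnorm (x j) ^+ 2.
have s0 : 0 <= s by apply: sumr_ge0 => j _; exact: sqr_ge0.
(* [s + 1] spares a square root, as [s <= (s + 1)^2]. *)
apply: (@le_lt_trans _ _ (s + 1)%:E); last exact: ltry.
apply/weak_l2_norm_trunc_leP => [|phi phi1]; first by rewrite addr_ge0.
apply: (@le_trans _ _ s); last first.
  by rewrite -subr_ge0 (_ : _ - _ = s ^+ 2 + s + 1) ?addr_ge0 ?sqr_ge0//; ring.
apply: ler_sum => j _; rewrite ler_pXn2r ?nnegrE ?rnorm_ge0//.
by apply: (le_trans (rnorm_dual_le _ _)); rewrite ler_piMl// rnorm_ge0.
Qed.

Lemma weak_l2_trunc_le m x (M : R) : 0 <= M ->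
  (weak_lp_norm 2%:E x <= M%:E)%E -> weak_l2_trunc m x <= M.
Proof.
move=> M0 /(weak_l2_norm_leP _ M0) xM.
rewrite -lee_fin -weak_l2_truncE; apply/weak_l2_norm_trunc_leP => // phi phi1.
apply: (le_trans (xM phi m)).
by rewrite ler_pXn2r ?nnegrE ?mulr_ge0 ?rnorm_ge0// ler_piMl.
Qed.

Lemma weak_l2_truncP (phi : dual E) m (x : nat -> E) :
  \sum_(j < m) rnorm (phi (x j)) ^+ 2 <= (rnorm phi * weak_l2_trunc m x) ^+ 2.
Proof.
have := lexx (weak_lp_norm 2%:E (trunc_seq m x)).
rewrite {2}weak_l2_truncE => /(weak_l2_norm_leP _ (weak_l2_trunc_ge0 m x)).
move=> /(_ phi m); congr (_ <= _); apply: eq_bigr => j _.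
by rewrite /trunc_seq ltn_ord.
Qed.

(** Squaring the triangle inequality and using [(b + c)^2 <= 2 (b^2 + c^2)] costs a harmless
    constant: the bound serves to keep [y] bounded near [x]. *)
Lemma weak_l2_norm_le_double (x y : nat -> E) (M d : R) : 0 <= M -> 0 <= d ->
  (weak_lp_norm 2%:E x <= M%:E)%E ->
  (weak_lp_norm 2%:E (fun j => y j - x j)%R <= d%:E)%E ->
  (weak_lp_norm 2%:E y <= (2 * (d + M))%:E)%E.
Proof.
move=> M0 d0 /(weak_l2_norm_leP _ M0) xM /(weak_l2_norm_leP _ d0) yd.
apply/weak_l2_norm_leP => [|phi m]; first by rewrite mulr_ge0// addr_ge0.
have := lerD (yd phi m) (xM phi m); rewrite -big_split /= => sumP.
apply: (@le_trans _ _ (2 * ((rnorm phi * d) ^+ 2 + (rnorm phi * M) ^+ 2))); last first.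
  rewrite (_ : rnorm phi * (2 * (d + M)) = 2 * (rnorm phi * d + rnorm phi * M));
    last by ring.
  have := mulr_ge0 (rnorm_ge0 phi) d0; have := mulr_ge0 (rnorm_ge0 phi) M0.
  move: (rnorm phi * d) (rnorm phi * M) => a b b0 a0.
  rewrite -subr_ge0 (_ : _ - _ = 2 * (a ^+ 2 + b ^+ 2 + 4 * (a * b))); last by ring.
  by rewrite mulr_ge0// !addr_ge0 ?sqr_ge0// !mulr_ge0.
apply: le_trans (ler_wpM2l _ sumP); last by [].
rewrite mulr_sumr; apply: ler_sum => j _.
have := @rnormD R k K^o (phi (y j - x j)) (phi (x j)).
rewrite -dual_addE subrK; have := rnorm_ge0 (phi (y j)).
set a := rnorm (phi (y j)); set b := rnorm (phi (y j - x j)) => a0.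
set c := rnorm (phi (x j)) => abc.
apply: (@le_trans _ _ ((b + c) ^+ 2)).
  by rewrite ler_pXn2r ?nnegrE// (le_trans a0 abc).
by rewrite -subr_ge0 (_ : _ - _ = (b - c) ^+ 2) ?sqr_ge0//; ring.
Qed.

End weak_norms.

(** * Finiteness of the weak 2-norm *)

Section uniform_weak_bounds.
Context {R : realType} {k : scalar_kind}.
Local Notation K := (scalars R k).

Lemma in_lp_fin_num (F : normedModType K) (p : \bar R) (y : nat -> F) :
  in_lp p y -> lp_norm p y \is a fin_num.
Proof. by move=> py; rewrite ge0_fin_numE ?Lnorm_ge0. Qed.

(** Membership only says that each form gives a square-summable sequence. By Cauchy-Schwarz the
    combinations of the [ev (x j)] with coefficients in the unit ball of l_2 are pointwise bounded
    on the dual, hence bounded in norm; well-chosen coefficients recover the weak norm. *)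
Lemma in_weak_l2_bounded (E : completeNormedModType K) (x : nat -> E) :
  in_weak_lp 2%:E x ->
  exists2 M : R, 0 <= M & (weak_lp_norm 2%:E x <= M%:E)%E.
Proof.
move=> x2.
have /choice[ev evE] := @evaluation_ex R k E.
pose G : set (dual (dual E)) := [set F | exists (m : nat) (b : nat -> K^o),
  \sum_(j < m) rnorm (b j) ^+ 2 <= 1 /\ F = \sum_(j < m) b j *: ev (x j)].
have GE m (b : nat -> K^o) (f : dual E) :
    (\sum_(j < m) b j *: ev (x j)) f = \sum_(j < m) b j * f (x j).
  by rewrite dual_sum; apply: eq_bigr => j _; rewrite dualZ evE.
have [M GM] : exists M, forall F, G F -> rnorm F <= M.
  apply: dual_banach_steinhaus => f.
  exists (fine (lp_norm 2%:E (f \o x))) => _ [m [b [b1 ->]]].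
  set N := fine _.
  have N0 : 0 <= N by rewrite fine_ge0// Lnorm_ge0.
  have /(lp_norm2_leP _ N0) fN : (lp_norm 2%:E (f \o x) <= N%:E)%E.
    by rewrite fineK// in_lp_fin_num//; exact: x2.
  rewrite GE; apply: (le_trans (rnorm_sum _ _ _)); rewrite -[leRHS]mul1r.
  under eq_bigr do rewrite rnormM.
  by apply: cauchy_schwarz_sum => //; rewrite expr1n.
have M0 : 0 <= M.
  apply: (@le_trans _ _ (rnorm (0 : dual (dual E)))); first exact: rnorm_ge0.
  by apply: GM; exists 0%N, (fun=> 0); rewrite !big_ord0.
exists M => //; apply/weak_lp_norm_leP => f f1; apply/lp_norm2_leP => // m.
set S := \sum_(j < m) _.
have S0 : 0 <= S by apply: sumr_ge0 => j _; exact: sqr_ge0.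
have [->|Sn0] := eqVneq S 0; first exact: sqr_ge0.
pose s := Num.sqrt S.
have s0 : 0 < s by rewrite sqrtr_gt0 lt_neqAle eq_sym Sn0.
have sS : s ^+ 2 = S by rewrite sqr_sqrtr.
have /choice[e eP] : forall j, exists c : K, rnorm (c : K^o) <= 1 /\
    c * f (x j) = of_real k (rnorm (f (x j))).
  by move=> j; have [c] := phase_ex (f (x j)); exists c.
(* The coefficients for which Cauchy-Schwarz is an equality: normalized moduli, with phases that
   make every term of the pairing nonnegative. *)
pose b j : K^o := of_real k (rnorm (f (x j)) / s) * e j.
have b1 : \sum_(j < m) rnorm (b j) ^+ 2 <= 1.
  rewrite -(mulfV Sn0) mulr_suml; apply: ler_sum => j _.
  rewrite /b rnormM rnorm_of_real; last by rewrite divr_ge0 ?rnorm_ge0 ?ltW.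
  rewrite 2!exprMn exprVn sS -[leRHS]mulr1 ler_wpM2l//.
    by rewrite mulr_ge0 ?sqr_ge0 ?invr_ge0.
  by rewrite expr_le1 ?rnorm_ge0//; have [] := eP j.
have : rnorm ((\sum_(j < m) b j *: ev (x j)) f) <= M.
  apply: (le_trans (rnorm_dual_le _ _)); rewrite -[leRHS]mulr1.
  by apply: ler_pM; rewrite ?rnorm_ge0//; apply: GM; exists m, b.
rewrite GE (_ : \sum_(j < m) _ = of_real k s); last first.
  transitivity (of_real k (\sum_(j < m) rnorm (f (x j)) ^+ 2 / s)).
    rewrite (big_morph _ (of_realD (k := k)) of_real0); apply: eq_bigr => j _.
    by rewrite /b -mulrA (eP j).2 -of_realM mulrAC -expr2.
  by rewrite -mulr_suml -/S -sS expr2 mulfK// gt_eqF.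
rewrite rnorm_of_real ?(ltW s0)// -sS => sM.
by rewrite ler_pXn2r ?nnegrE ?(ltW s0).
Qed.

End uniform_weak_bounds.

(** * Pairing the projective tensor product with weakly 2-summable sequences *)

Section littlewood_orlicz.
Context {R : realType} {k : scalar_kind}.
Local Notation K := (scalars R k).
Context {E : normedModType K}.

(** Choosing each [e j] to cancel the phase of [F (f j)] makes the sum of the moduli the value of
    [F] at one combination of the [f j]. Forms on the dual thereby disappear from the estimate. *)
Lemma weak_l1_norm_signs (m : nat) (f : nat -> dual E) (L : R) :
  (forall e : nat -> K, (forall j, rnorm (e j : K^o) <= 1) ->
    rnorm (\sum_(j < m) e j *: f j) <= L) ->
  (weak_lp_norm 1 (trunc_seq m f) <= L%:E)%E.
Proof.
move=> fL; apply/weak_l1_norm_trunc_leP => F F1.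
have /choice[e eP] : forall j, exists c : K, rnorm (c : K^o) <= 1 /\
    c * F (f j) = of_real k (rnorm (F (f j))).
  by move=> j; have [c] := phase_ex (F (f j)); exists c.
have e1 j : rnorm (e j : K^o) <= 1 by have [] := eP j.
apply: le_trans (fL e e1).
have <- : rnorm (F (\sum_(j < m) e j *: f j)) = \sum_(j < m) rnorm (F (f j)).
  rewrite -[RHS](rnorm_of_real (k := k)); last first.
    by apply: sumr_ge0 => j _; exact: rnorm_ge0.
  congr rnorm; rewrite dual_form_sum (big_morph _ (of_realD (k := k)) of_real0).
  by apply: eq_bigr => j _; rewrite dual_scaleE (eP j).2.
by apply: (le_trans (rnorm_dual_le _ _)); rewrite ler_piMl ?rnorm_ge0.
Qed.

(** For an elementary tensor, Cauchy-Schwarz separates the l_2 norm of the coefficients from [x]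
    tested against the form [z l]; these bounds are added over a representation of cost less than
    [t]. *)
Lemma projective_norm_pairing (u : nat -> dual E) (t : R) (m : nat)
    (x : nat -> E) :
  (projective_norm u < t%:E)%E ->
  \sum_(j < m) rnorm (u j (x j)) <= t * weak_l2_trunc m x.
Proof.
move=> /ereal_inf_lt[_ [p [a [z [[a2 uE] ->]]]]].
pose A l := fine (lp_norm 2%:E (a l)).
have AE l : lp_norm 2%:E (a l) = (A l)%:E by rewrite fineK// in_lp_fin_num.
have A0 l : 0 <= A l by rewrite fine_ge0// Lnorm_ge0.
under eq_bigr do rewrite AE -EFinM.
rewrite sumEFin lte_fin => /ltW At.
apply: le_trans (ler_wpM2r (weak_l2_trunc_ge0 m x) At).
rewrite mulr_suml.
apply: (@le_trans _ _ (\sum_(j < m) \sum_(l < p) rnorm (a l j) * rnorm (z l (x j)))).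
  apply: ler_sum => j _; rewrite uE dual_sum.
  apply: (le_trans (rnorm_sum _ _ _)).
  by apply: ler_sum => l _; rewrite dualZ -rnormM.
rewrite exchange_big; apply: ler_sum => l _; rewrite -mulrA.
apply: cauchy_schwarz_sum => //=.
- by rewrite mulr_ge0 ?rnorm_ge0 ?weak_l2_trunc_ge0.
- have : (lp_norm 2%:E (a l) <= (A l)%:E)%E by rewrite AE.
  by move/(lp_norm2_leP _ (A0 l))/(_ m).
- exact: weak_l2_truncP.
Qed.

(** Only [m] terms are paired with [x], so convergence of each [v n j] suffices to pass to the
    limit. *)
Lemma projective_limit_pairing (v : nat -> nat -> dual E) (u : nat -> dual E)
    (t : R) (m : nat) (x : nat -> E) :
  projective_limit v u -> (\forall n \near \oo, projective_norm (v n) < t%:E)%E ->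
  \sum_(j < m) rnorm (u j (x j)) <= t * weak_l2_trunc m x.
Proof.
move=> [_ _ vu] vt; apply/ler_addgt0Pl => d d0.
pose X := \sum_(j < m) rnorm (x j).
have X0 : 0 <= X by apply: sumr_ge0 => j _; exact: rnorm_ge0.
have X1 : 0 < X + 1 by rewrite ltr_wpDl.
have near_u : \forall n \near \oo, forall j : 'I_m,
    rnorm (u j - v n j) < d / (X + 1).
  apply: filter_forall => j.
  by move/cvg_rnormP : (vu j) => /(_ (d / (X + 1))); apply; rewrite divr_gt0.
near \oo => n.
have near_uj : forall j : 'I_m, rnorm (u j - v n j) < d / (X + 1) by near: n.
apply: (@le_trans _ _ (\sum_(j < m) (d / (X + 1) * rnorm (x j) + rnorm (v n j (x j))))).
  apply: ler_sum => j _; rewrite -[u j (x j)](subrK (v n j (x j))).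
  apply: (le_trans (rnormD _ _)); rewrite lerD2r -dual_sub.
  by apply: (le_trans (rnorm_dual_le _ _)); rewrite ler_wpM2r ?rnorm_ge0// ltW.
rewrite big_split /= -mulr_sumr; apply: lerD.
  by rewrite -/X mulrAC ler_pdivrMr// ler_pM2l// lerDl.
by apply: projective_norm_pairing; near: n.
Unshelve. all: by end_near. Qed.

(** The constant is that of the continuous inclusion, hence the same for all [m], [f] and [x]. *)
Lemma Littlewood_Orlicz_pairing : Littlewood_Orlicz (dual E) ->
  exists2 C : R, 0 <= C & forall (m : nat) (f : nat -> dual E) (x : nat -> E) (L : R),
    0 <= L -> (weak_lp_norm 1 (trunc_seq m f) <= L%:E)%E ->
    \sum_(j < m) rnorm (f j (x j)) <= C * L * weak_l2_trunc m x.
Proof.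
move=> [_ [C C0 LO]]; exists C => [|m f x L L0 fL]; first exact: ltW.
have f1 : in_weak_lp 1 (trunc_seq m f).
  move=> F; have /(weak_l1_norm_leP _ L0) FL := fL.
  by apply: le_lt_trans (ltry (rnorm F * L)); apply/lp_norm1_leP => p; exact: FL.
have normf : (projective_tensor_norm (trunc_seq m f) <= (C * L)%:E)%E.
  by apply: (le_trans (LO _ f1)); rewrite EFinM lee_pmul2l// lte_fin.
apply/ler_addgt0Pl => d d0.
have w0 := weak_l2_trunc_ge0 m x.
(* This slack, present because the infimum may not be attained, adds at most [d] to the estimate;
   the 1 in the denominator covers a vanishing weak norm. *)
pose e := d / (weak_l2_trunc m x + 1).
have e0 : 0 < e by rewrite divr_gt0// ltr_wpDl.
have : (projective_tensor_norm (trunc_seq m f) < (C * L + e)%:E)%E.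
  by apply: le_lt_trans normf _; rewrite lte_fin ltrDl.
move=> /ereal_inf_lt[s [v [vf vs]] sCL].
have near_s : (\forall n \near \oo, projective_norm (v n) < (C * L + e)%:E)%E.
  apply: (vs [set y | (y < (C * L + e)%:E)%E]).
  by apply: open_nbhs_nbhs; split; first exact: open_ereal_lt_ereal.
have := projective_limit_pairing m x vf near_s.
rewrite (eq_bigr (fun j : 'I_m => rnorm (f j (x j)))); last first.
  by move=> j _; rewrite /trunc_seq ltn_ord.
move=> /le_trans; apply; rewrite mulrDl addrC lerD2r /e mulrAC.
by rewrite ler_pdivrMr ?ltr_wpDl// ler_pM2l// lerDl.
Qed.

End littlewood_orlicz.

(** * Multilinear maps with some sequences held constant *)

Section dependent_updates.
Context {I : eqType} {T : I -> Type}.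
Implicit Type f : forall i, T i.

Lemma dfwithC f i j (x : T i) (y : T j) : i != j ->
  dfwith (dfwith f i x) j y = dfwith (dfwith f j y) i x.
Proof.
move=> ij; apply: functional_extensionality_dep => l.
have [{l}<-|il] := eqVneq i l.
  by rewrite dfwithin dfwithout 1?eq_sym// dfwithin.
rewrite [RHS]dfwithout//; have [{l il}<-|jl] := eqVneq j l.
  by rewrite !dfwithin.
by rewrite !dfwithout.
Qed.

End dependent_updates.

Lemma continuous_into_product (X : topologicalType) (I : eqType)
    (T : I -> topologicalType) (f : X -> prod_topology T) :
  (forall i, continuous (fun x => f x i)) -> continuous f.
Proof.
move=> cf x; apply/cvg_sup => i U [_ [[W oW <-]] Wfx] WU.
apply: (filterS WU); apply: (cf i x); exact: open_nbhs_nbhs.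
Qed.

Section mixed_summing.
Context {R : realType} {k : scalar_kind}.
Local Notation K := (scalars R k).
Context {I : finType} (E : I -> completeNormedModType K).
Variable A : (forall i, E i) -> K^o.

Lemma multilinear_slice : bounded_multilinear (E := E) (F := K^o) A ->
  forall (g : forall i, E i) (i : I), exists f : dual (E i),
    forall u, f u = A (dfwith g i u).
Proof.
move=> [mA cA] g i.
have Lin : (fun u : E i => A (dfwith g i u)) \in @continuous_linear_form R k (E i).
  rewrite inE; split; first exact: mA.
  move=> u.
  apply: (@continuous_comp _ (prod_topology E) K^o (dfwith g i) A u).
    exact: (@dfwith_continuous I E g i u).
  exact: cA.
by exists (Dual Lin).
Qed.

Definition mixed_point (S : {set I}) (z : forall i, E i)
    (x : forall i, nat -> E i) (j : nat) : forall i, E i :=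
  fun i => if i \in S then x i j else z i.

(** [C] may depend on the fixed vectors [z]; its dependence on one of them is controlled afterwards
    by uniform boundedness. *)
Definition mixed_summing (S : {set I}) : Prop :=
  forall z : forall i, E i, exists2 C : R, 0 <= C &
  forall (m : nat) (x : forall i, nat -> E i),
    \sum_(j < m) rnorm (A (mixed_point S z x j)) <=
    C * \prod_(i in S) weak_l2_trunc m (x i).

Lemma mixed_point_dfwith (S : {set I}) (i0 : I) z x j (u : E i0) : i0 \notin S ->
  mixed_point S (dfwith z i0 u) x j = dfwith (mixed_point S z x j) i0 u.
Proof.
move=> i0S; apply: functional_extensionality_dep => i; rewrite /mixed_point.
have [{i}<-|ii0] := eqVneq i0 i; first by rewrite (negPf i0S) !dfwithin.
by rewrite !dfwithout.
Qed.

Lemma mixed_point_setU1 (S : {set I}) (i0 : I) z x j :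
  mixed_point (i0 |: S) z x j = dfwith (mixed_point S z x j) i0 (x i0 j).
Proof.
apply: functional_extensionality_dep => i; rewrite /mixed_point !inE.
have [{i}<-|ii0] := eqVneq i0 i; first by rewrite dfwithin.
by rewrite dfwithout.
Qed.

(* Uniform boundedness is applied to the forms divided by the product of the
   weak norms; when this product is 0, so is the quotient in Rocq, and the forms
   themselves vanish. *)
Lemma mixed_summing_uniform (S : {set I}) (i0 : I) z :
  bounded_multilinear (E := E) (F := K^o) A -> i0 \notin S -> mixed_summing S ->
  exists sl : (forall i, E i) -> dual (E i0),
  (forall g u, sl g u = A (dfwith g i0 u)) /\
  exists2 C : R, 0 <= C & forall (m : nat) (x : forall i, nat -> E i)
    (e : nat -> K), (forall j, rnorm (e j : K^o) <= 1) ->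
    rnorm (\sum_(j < m) e j *: sl (mixed_point S z x j)) <=
    C * \prod_(i in S) weak_l2_trunc m (x i).
Proof.
move=> Ab i0S AS.
have /choice[sl slE] g : exists f : dual (E i0), forall u, f u = A (dfwith g i0 u).
  exact: multilinear_slice.
exists sl; split => //.
pose P m (x : forall i, nat -> E i) := \prod_(i in S) weak_l2_trunc m (x i).
have P0 m x : 0 <= P m x by apply: prodr_ge0 => i _; exact: weak_l2_trunc_ge0.
have /choice[C CP] u : exists C : R, 0 <= C /\ forall m x (e : nat -> K),
    (forall j, rnorm (e j : K^o) <= 1) ->
    rnorm ((\sum_(j < m) e j *: sl (mixed_point S z x j)) u) <= C * P m x.
  (* Placing [u] at coordinate [i0] of the fixed vectors turns the hypothesis on [S] into a bound at
     [u]. *)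
  have [C C0 Cu] := AS (dfwith z i0 u); exists C; split => // m x e e1.
  apply: le_trans (Cu m x); rewrite dual_sum.
  apply: (le_trans (rnorm_sum _ _ _)); apply: ler_sum => j _.
  rewrite dualZ slE mixed_point_dfwith// rnormZ ler_piMl//.
  exact: rnorm_ge0.
pose G : set (dual (E i0)) := [set f | exists m x (e : nat -> K),
  (forall j, rnorm (e j : K^o) <= 1) /\
  f = of_real k (P m x)^-1 *: (\sum_(j < m) e j *: sl (mixed_point S z x j))].
have [M GM] : exists M, forall f, G f -> rnorm f <= M.
  apply: dual_banach_steinhaus => u; exists (C u) => _ [m [x [e [e1 ->]]]].
  have [C0 Cu] := CP u.
  rewrite dualZ rnormZ rnorm_of_real ?invr_ge0//.
  have [Pn|Pn] := eqVneq (P m x) 0; first by rewrite Pn invr0 mul0r.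
  rewrite mulrC ler_pdivrMr ?Cu//.
  by rewrite lt_neqAle eq_sym Pn P0.
exists `|M| => // m x e e1; rewrite -/(P m x).
have [Pn|Pn] := eqVneq (P m x) 0.
  rewrite Pn mulr0; apply: rnorm_dual_bound => // u.
  by have [_ /(_ m x e e1)] := CP u; rewrite Pn mulr0 mul0r.
have Pgt0 : 0 < P m x by rewrite lt_neqAle eq_sym Pn P0.
rewrite -ler_pdivrMr// mulrC; apply: le_trans (ler_norm M).
rewrite -[(P m x)^-1](rnorm_of_real (k := k)) ?invr_ge0// -rnormZ.
by apply: GM; exists m, x, e.
Qed.

(** By uniform boundedness, the forms obtained by leaving coordinate [i0] free have weak 1-norm at
    most [M] times the product of the weak norms over [S]; the Littlewood-Orlicz property pairs them
    with [x i0]. Neither [C] nor [M] depends on [m] or [x]. *)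
Lemma mixed_summing_step (S : {set I}) (i0 : I) :
  bounded_multilinear (E := E) (F := K^o) A -> i0 \notin S ->
  Littlewood_Orlicz (dual (E i0)) -> mixed_summing S ->
  mixed_summing (i0 |: S).
Proof.
move=> Ab i0S /Littlewood_Orlicz_pairing[C C0 LO] AS z.
have [sl [slE [M M0 slM]]] := mixed_summing_uniform z Ab i0S AS.
exists (C * M) => [|m x]; first exact: mulr_ge0.
pose P := \prod_(i in S) weak_l2_trunc m (x i).
have P0 : 0 <= P by apply: prodr_ge0 => i _; exact: weak_l2_trunc_ge0.
rewrite (eq_bigr (fun j : 'I_m => rnorm (sl (mixed_point S z x j) (x i0 j)))); last first.
  by move=> j _; rewrite slE mixed_point_setU1.
rewrite big_setU1//= -/P (mulrC (weak_l2_trunc _ _)) mulrA -(mulrA C).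
apply: (LO m (fun j => sl (mixed_point S z x j)) (x i0)); first exact: mulr_ge0.
by apply: weak_l1_norm_signs => e e1; exact: slM.
Qed.

End mixed_summing.

(** * The first two coordinates *)

Section two_coordinates.
Context {R : realType} {k : scalar_kind}.
Local Notation K := (scalars R k).
Context {n : nat} (hn : (2 <= n)%N) (E : 'I_n -> completeNormedModType K).
Variable A : (forall i, E i) -> K^o.
Local Notation w0 := (widen_ord hn ord0).
Local Notation w1 := (widen_ord hn ord_max).

Let w01 : w0 != w1. Proof. by []. Qed.

Lemma ord2P (i : 'I_2) : i = ord0 \/ i = ord_max.
Proof. by case: i => -[|[|//]] p; [left|right]; apply: val_inj. Qed.

(** Composed with [A], it gives the bilinear form on the first two spaces to which the hypothesis of
    2-domination applies. *)
Definition two_coordinates_point (z : forall i, E i)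
    (x : forall i : 'I_2, E (widen_ord hn i)) : forall i, E i :=
  dfwith (dfwith z w0 (x ord0)) w1 (x ord_max).

Lemma two_coordinates_bounded z : bounded_multilinear (E := E) (F := K^o) A ->
  bounded_multilinear (E := fun i : 'I_2 => E (widen_ord hn i)) (F := K^o)
    (A \o two_coordinates_point z).
Proof.
move=> [mA cA]; split.
  move=> x i; rewrite /two_coordinates_point /=.
  have [->|->] := ord2P i.
    (* Multilinearity of [A] concerns the outermost update, so the two updates are exchanged. *)
    under [fun u => _]funext => u.
      rewrite dfwithin dfwithout// dfwithC//.
      over.
    exact: mA.
  under [fun u => _]funext => u.
    rewrite dfwithin dfwithout//.
    over.
  exact: mA.
move=> x; apply: (@continuous_comp (prod_topology (fun i : 'I_2 => E (widen_ord hn i)))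
  (prod_topology E) K^o (two_coordinates_point z) A x); last exact: cA.
(* Each coordinate of the point is a projection or constant. *)
apply: continuous_into_product => i {}x.
have [{i}<-|w1i] := eqVneq w1 i.
  rewrite [X in continuous_at x X](_ : _ = @proj _ (fun i => E (widen_ord hn i)) ord_max).
    exact: (@proj_continuous _ (fun i : 'I_2 => E (widen_ord hn i)) ord_max x).
  by apply/funext => y; rewrite /two_coordinates_point dfwithin.
have [{i w1i}<-|w0i] := eqVneq w0 i.
  rewrite [X in continuous_at x X](_ : _ = @proj _ (fun i => E (widen_ord hn i)) ord0).
    exact: (@proj_continuous _ (fun i : 'I_2 => E (widen_ord hn i)) ord0 x).
  by apply/funext => y; rewrite /two_coordinates_point dfwithout// dfwithin.
rewrite [X in continuous_at x X](_ : _ = cst (z i)); first exact: cst_continuous.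
by apply/funext => y; rewrite /two_coordinates_point !dfwithout.
Qed.

Lemma mixed_summing_two_dominated :
  (forall B : (forall i : 'I_2, E (widen_ord hn i)) -> K^o,
    bounded_multilinear (E := fun i : 'I_2 => E (widen_ord hn i)) (F := K^o) B ->
    two_dominated (E := fun i : 'I_2 => E (widen_ord hn i)) B) ->
  bounded_multilinear (E := E) (F := K^o) A ->
  mixed_summing A [set i : 'I_n | (i < 2)%N]%SET.
Proof.
move=> dom Ab z.
have [C C0 BC] := dom _ (two_coordinates_bounded z Ab).
exists C => [|m x]; first exact: ltW.
have := BC m (fun i => x (widen_ord hn i)).
rewrite (eq_bigr (fun i : 'I_2 => (weak_l2_trunc m (x (widen_ord hn i)))%:E)); last first.
  by move=> i _; rewrite weak_l2_truncE.
rewrite prodEFin -EFinM => /lp_norm1_trunc_leP.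
rewrite !big_ord_recl big_ord0 mulr1.
have -> : [set i : 'I_n | (i < 2)%N]%SET = (w0 |: [set w1])%SET.
  apply/setP => i; rewrite !inE -!val_eqE /=.
  by case: (val i) => [|[|]].
rewrite big_setU1/= ?inE// big_set1.
have -> : lift ord0 ord0 = ord_max :> 'I_2 by apply: val_inj.
congr (_ <= _); apply: eq_bigr => j _; congr (rnorm (A _)).
rewrite mixed_point_setU1 (_ : mixed_point _ _ _ _ = dfwith z w1 (x w1 j)).
  by rewrite dfwithC.
apply: functional_extensionality_dep => i; rewrite /mixed_point inE.
have [{i}<-|w1i] := eqVneq w1 i; first by rewrite dfwithin.
by rewrite dfwithout.
Qed.

End two_coordinates.

(** * From the finite estimate to summability and continuity *)

Section from_estimate_to_summing.
Context {R : realType} {k : scalar_kind}.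
Local Notation K := (scalars R k).
Context {I : finType} (E : I -> completeNormedModType K).
Variable A : (forall i, E i) -> K^o.
Variable C : R.
Hypothesis C0 : 0 <= C.
Hypothesis AP : forall (m : nat) (x : forall i, nat -> E i),
  \sum_(j < m) rnorm (A (fun i => x i j)) <= C * \prod_i weak_l2_trunc m (x i).

Lemma estimate_absolutely_summing :
  absolutely_summing (E := E) (F := K^o) 1%E (fun=> 2%:E)%E A.
Proof.
(* The definition asks for a positive constant, while [C] may be 0. *)
exists (C + 1) => [|m x]; first by rewrite ltr_wpDl.
rewrite (eq_bigr (fun i => (weak_l2_trunc m (x i))%:E)); last first.
  by move=> i _; rewrite weak_l2_truncE.
rewrite prodEFin -EFinM; apply/lp_norm1_trunc_leP.
apply: (le_trans (AP m x)); apply: ler_wpM2r; last by rewrite lerDl.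
by apply: prodr_ge0 => i _; exact: weak_l2_trunc_ge0.
Qed.

Lemma estimate_bounded (m : nat) (x : forall i, nat -> E i) (L : R) : 
  (forall i, weak_l2_trunc m (x i) <= L) ->
  \sum_(j < m) rnorm (A (fun i => x i j)) <= C * \prod_(i : I) L.
Proof.
move=> xL; apply: (le_trans (AP m x)); rewrite ler_wpM2l//.
by apply: ler_prod => i _; rewrite weak_l2_trunc_ge0 xL.
Qed.

(** Keeping the full power of [L], which [1 <= L] allows, gives a bound that is the same for every
    [i0]. *)
Lemma estimate_small (m : nat) (x : forall i, nat -> E i) (i0 : I) (L d : R) :
  1 <= L -> weak_l2_trunc m (x i0) <= d ->
  (forall i, i != i0 -> weak_l2_trunc m (x i) <= L) ->
  \sum_(j < m) rnorm (A (fun i => x i j)) <= C * (d * \prod_(i : I) L).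
Proof.
move=> L1 xd xL; apply: (le_trans (AP m x)); rewrite ler_wpM2l//.
have PL0 : 0 <= \prod_(i | i != i0) L by apply: prodr_ge0 => i _; apply: le_trans L1.
rewrite (bigD1 i0)//= [X in d * X](bigD1 i0)//=; apply: ler_pM => //.
- exact: weak_l2_trunc_ge0.
- by apply: prodr_ge0 => i _; exact: weak_l2_trunc_ge0.
- apply: (@le_trans _ _ (\prod_(i | i != i0) L)); last by rewrite ler_peMl.
  by apply: ler_prod => i ii0; rewrite weak_l2_trunc_ge0 xL.
Qed.

(** The intermediate points of a telescoping from [x] to [y], with the coordinates listed in [r]
    already replaced. *)
Definition hybrid (T : I -> Type) (r : seq I) (y x : forall i, T i) : forall i, T i :=
  fun i => if i \in r then y i else x i.

Hypothesis mA : multilinear (E := E) (F := K^o) A.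

Lemma multilinear_dfwithB (g : forall i, E i) (i : I) (u v : E i) :
  A (dfwith g i u) - A (dfwith g i v) = A (dfwith g i (u - v)).
Proof.
have := @mA g i (-1) v u; rewrite !scaleN1r => /= E1.
by rewrite (addrC u) E1 addrC.
Qed.

(** Coordinates are replaced one at a time; by multilinearity each replacement contributes values of
    [A] with one entry from [y i - x i], to which [estimate_small] applies. *)
Lemma estimate_difference (m : nat) (x y : forall i, nat -> E i) (L d : R) (r : seq I) :
  1 <= L -> uniq r ->
  (forall i, weak_l2_trunc m (x i) <= L) ->
  (forall i, weak_l2_trunc m (y i) <= L) ->
  (forall i, weak_l2_trunc m (fun j => y i j - x i j) <= d) ->
  \sum_(j < m) rnorm (A (fun i => hybrid r y x i j) - A (fun i => x i j)) <=
  (size r)%:R * (C * (d * \prod_(i : I) L)).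
Proof.
move=> L1 + xL yL yxd; elim: r => [_|i r IH /= /andP[ir ur]].
  by rewrite mul0r big1// => j _; rewrite subrr rnorm0.
rewrite -add1n natrD mulrDl mul1r.
pose s := dfwith (hybrid r y x) i (fun j => y i j - x i j).
have sE j : A (fun l => hybrid (i :: r) y x l j) - A (fun l => hybrid r y x l j) =
    A (fun l => s l j).
  pose g : forall l, E l := fun l => hybrid r y x l j.
  transitivity (A (dfwith g i (y i j)) - A (dfwith g i (x i j))).
    congr (A _ - A _); apply: functional_extensionality_dep => l.
      rewrite /hybrid inE; have [{l}<-|il] := eqVneq i l; first by rewrite dfwithin.
      by rewrite dfwithout.
    rewrite /g /hybrid; have [{l}<-|il] := eqVneq i l; last by rewrite dfwithout.
    by rewrite dfwithin (negPf ir).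
  rewrite multilinear_dfwithB; congr (A _).
  apply: functional_extensionality_dep => l; rewrite /s.
  have [{l}<-|il] := eqVneq i l; first by rewrite !dfwithin.
  by rewrite !dfwithout.
apply: (@le_trans _ _ (\sum_(j < m) rnorm (A (fun l => s l j)) +
    \sum_(j < m) rnorm (A (fun l => hybrid r y x l j) - A (fun l => x l j)))).
  rewrite -big_split /=; apply: ler_sum => j _; rewrite -sE.
  by apply: le_trans (rnormD _ _); rewrite subrKA.
apply: lerD; last exact: IH.
apply: (@estimate_small _ _ i) => // [|l li]; rewrite /s.
  by rewrite dfwithin.
by rewrite dfwithout 1?eq_sym// /hybrid; case: ifP.
Qed.

Lemma estimate_induced_bounded :
  induced_bounded (E := E) (F := K^o) 1%E (fun=> 2%:E)%E A.
Proof.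
(* Uniform boundedness makes each weak norm finite; the sum of the nonnegative [M i] is a common
   bound. *)
have bounded (x : forall i, nat -> E i) : (forall i, in_weak_lp 2%:E (x i)) ->
    exists2 M : R, 0 <= M & forall i, (weak_lp_norm 2%:E (x i) <= M%:E)%E.
  move=> x2.
  have /choice[M MP] i : exists M : R, 0 <= M /\ (weak_lp_norm 2%:E (x i) <= M%:E)%E.
    by have [M M0 xM] := in_weak_l2_bounded (x2 i); exists M.
  exists (\sum_i M i) => [|i]; first by apply: sumr_ge0 => i _; have [] := MP i.
  apply: (le_trans (MP i).2); rewrite lee_fin (bigD1 i)//= lerDl.
  by apply: sumr_ge0 => l _; have [] := MP l.
split=> [x /bounded[M M0 xM]|x /bounded[M M0 xM] e e0].
  apply: le_lt_trans (ltry (C * \prod_(i : I) M)).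
  apply/lp_norm1_leP => m; apply: estimate_bounded => i.
  exact: weak_l2_trunc_le.
(* [L] bounds the norms of [x] and of every [y] within distance 1. *)
pose L := 2 * (1 + M).
have L1 : 1 <= L by rewrite /L; lra.
pose D := (size (enum I))%:R * (C * \prod_(i : I) L).
have D0 : 0 <= D.
  by rewrite !mulr_ge0// prodr_ge0// => i _; exact: le_trans L1.
(* The 1 keeps [y] within the range of [L]; the quotient makes [d * D] smaller than [e], also when
   [D] vanishes. *)
pose d := Num.min 1 (e / (D + 1)).
have d0 : 0 < d by rewrite lt_min ltr01 divr_gt0// ltr_wpDl.
have dD : d * D < e.
  apply: (@le_lt_trans _ _ (e / (D + 1) * D)).
    by rewrite ler_wpM2r// ge_min lexx orbT.
  by rewrite mulrAC ltr_pdivrMr ?ltr_wpDl// ltr_pM2l// ltrDl.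
exists d => // y y2 yx.
apply: (@le_lt_trans _ _ (d * D)%:E); last by rewrite lte_fin.
apply/lp_norm1_leP => m.
have := @estimate_difference m x y L d (enum I) L1 (enum_uniq I).
have -> : d * D = (size (enum I))%:R * (C * (d * \prod_(i : I) L)) by rewrite /D; ring.
have -> : hybrid (enum I) y x = y.
  by apply: functional_extensionality_dep => i; rewrite /hybrid mem_enum.
apply=> i.
- apply: weak_l2_trunc_le; first exact: le_trans L1.
  by apply: le_trans (xM i) _; rewrite lee_fin /L; lra.
- apply: weak_l2_trunc_le; first exact: le_trans L1.
  have := weak_l2_norm_le_double M0 (ltW d0) (xM i) (ltW (yx i)).
  move/le_trans; apply; rewrite lee_fin ler_pM2l// lerD2r.
  by rewrite ge_min lexx.
- by apply: weak_l2_trunc_le; [exact: ltW|exact: ltW (yx i)].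
Qed.

End from_estimate_to_summing.

(** * Induction on the coordinates and conclusion *)

Lemma mixed_summing_all (R : realType) (k : scalar_kind) (n : nat) (hn : (2 <= n)%N)
    (E : 'I_n -> completeNormedModType (scalars R k))
    (A : (forall i, E i) -> (scalars R k)^o) :
  (forall i : 'I_n, (2 <= i)%N -> Littlewood_Orlicz (dual (E i))) ->
  bounded_multilinear (E := E) (F := (scalars R k)^o) A ->
  mixed_summing A [set i : 'I_n | (i < 2)%N]%SET ->
  mixed_summing A [set: 'I_n]%SET.
Proof.
move=> LO Ab A2.
(* Counting from [p.+2] matches the base case and gives each added coordinate an index at least 2,
   where the Littlewood-Orlicz property is assumed. *)
have all_below p : (p.+2 <= n)%N -> mixed_summing A [set i : 'I_n | (i < p.+2)%N]%SET.
elim: p => // p IH pn.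
  have -> : [set i : 'I_n | (i < p.+3)%N]%SET =
      (Ordinal pn |: [set i : 'I_n | (i < p.+2)%N])%SET.
    by apply/setP => i; rewrite !inE -val_eqE /= ltnS leq_eqVlt.
  apply: mixed_summing_step => //; first by rewrite inE ltnn.
    exact: LO.
  exact: IH (ltnW pn).
have n2 : n.-2.+2 = n by rewrite -[RHS](subnKC hn) subn2.
have := all_below n.-2; rewrite n2 leqnn => /(_ isT).
by congr (mixed_summing A _); apply/setP => i; rewrite !inE ltn_ord.
Qed.

Theorem theorem4p3 (R : realType) (k : scalar_kind) (n : nat) (hn : (2 <= n)%N)
    (E : 'I_n -> completeNormedModType (scalars R k))
    (hLO : forall i : 'I_n, (2 <= i)%N -> Littlewood_Orlicz (dual (E i)))
    (hdom : forall B : (forall i : 'I_2, E (widen_ord hn i)) -> (scalars R k)^o,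
      bounded_multilinear B -> two_dominated B) :
  (forall A : (forall i : 'I_n, E i) -> (scalars R k)^o,
     bounded_multilinear A -> induced_bounded 1%E (fun=> 2%:E)%E A) /\
  bounded_multilinear (E := E) (F := (scalars R k)^o) =
  summing_maps 1%E (fun=> 2%:E)%E.
Proof.
have estimate (A : (forall i : 'I_n, E i) -> (scalars R k)^o) :
    bounded_multilinear A -> exists2 C : R, 0 <= C &
    forall (m : nat) (x : forall i, nat -> E i),
    \sum_(j < m) rnorm (A (fun i => x i j)) <= C * \prod_i weak_l2_trunc m (x i).
  move=> Ab.
  (* All coordinates vary here, so any base point will do. *)
  have [|C C0 AP] := @mixed_summing_all _ _ _ hn E A hLO Ab _ (fun=> 0).
    exact: mixed_summing_two_dominated.
  exists C => // m x; have := AP m x.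
  under [X in _ <= C * X]eq_bigl do rewrite inE.
  congr (_ <= _); apply: eq_bigr => j _; congr (rnorm (A _)).
  by apply: functional_extensionality_dep => i; rewrite /mixed_point inE.
split=> [A Ab|].
  have [C C0 AP] := estimate A Ab.
  by apply: estimate_induced_bounded C0 AP _; have [] := Ab.
apply/seteqP; split=> [A Ab|A []//]; split => //.
by have [C C0 AP] := estimate A Ab; exact: estimate_absolutely_summing C0 AP.
Qed.
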